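(* Let $q$ be a prime power, $E=\mathbb{F}_q^n$, and $1<k_1<k_2<n$. Let $\mathcal{M}_1=\mathcal{U}_{k_1,n}(q)$ and $\mathcal{M}_2=\mathcal{U}_{k_2,n}(q)$. Let $a,\mu$ be integers with $a\ge1$, $\mu\ge2$, let $\lambda=\frac{a}{\mu}$ with $0<\lambda<1$, and let $\mathcal{M}=(1-\lambda)\mathcal{M}_1+\lambda\mathcal{M}_2$. If $\mu\ge\lceil n/k_1\rceil$, then every subspace of $E$ is $\mu$-independent in $\mathcal{M}$, i.e. $\mathcal{I}_\mu(\mathcal{M})=\mathcal{L}(E)$.
   Context: $\mathcal{L}(E)$ is the lattice of subspaces of $E$. The uniform $q$-matroid $\mathcal{U}_{k,n}(q)$ has rank function $\rho(V)=\min\{k,\dim V\}$ on $\mathcal{L}(E)$. For $q$-polymatroids with rank functions $\rho_1,\rho_2$, $(1-\lambda)\mathcal{M}_1+\lambda\mathcal{M}_2$ is the $q$-polymatroid with rank function $(1-\lambda)\rho_1+\lambda\rho_2$. A positive rational $\mu$ with $\mu\rho(X)\in\mathbb{Z}_{\ge0}$ for all $X$ is a denominator (here $\mu$ is one). A space $I$ is $\mu$-independent if $\rho(J)\ge\dim(J)/\mu$ for all $J\le I$; $\mathcal{I}_\mu(\mathcal{M})$ is the set of $\mu$-independent spaces. *)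

(* Defs.v *)
From HB Require Import structures.
From mathcomp Require Import all_boot all_order all_algebra.
From mathcomp Require Import zify ring lra.

Set Implicit Arguments.
Unset Strict Implicit.
Unset Printing Implicit Defensive.

Import Order.TTheory GRing.Theory Num.Theory.
Local Open Scope ring_scope.

(* The lattice of subspaces of E is the type {vspace E}. *)
Record qPolymatroid (F : finFieldType) (E : vectType F) := QPolymatroid {
  qrank :> {vspace E} -> rat;
  qrank_bounds : forall V, 0 <= qrank V <= (\dim V)%:R;
  qrank_mono : forall V W : {vspace E}, (V <= W)%VS -> qrank V <= qrank W;
  qrank_submod : forall V W : {vspace E},
    qrank (V + W)%VS + qrank (V :&: W)%VS <= qrank V + qrank W
}.

Section Constructions.
Variables (F : finFieldType) (E : vectType F).
Implicit Types (V W : {vspace E}) (M : qPolymatroid E).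

Definition uniform_rank (k : nat) (V : {vspace E}) : rat :=
  (minn k (\dim V))%:R.

Fact uniform_rank_bounds k V : 0 <= uniform_rank k V <= (\dim V)%:R.
Proof. by rewrite ler0n ler_nat geq_minr. Qed.

Fact uniform_rank_mono k V W :
  (V <= W)%VS -> uniform_rank k V <= uniform_rank k W.
Proof. by move=> /dimvS sVW; rewrite ler_nat; lia. Qed.

Fact uniform_rank_submod k V W :
  uniform_rank k (V + W)%VS + uniform_rank k (V :&: W)%VS
    <= uniform_rank k V + uniform_rank k W.
Proof.
rewrite -!natrD ler_nat; have := dimv_sum_cap V W.
have := dimvS (addvSl V W); have := dimvS (addvSr V W).
by have := dimvS (capvSl V W); have := dimvS (capvSr V W); lia.
Qed.

Definition uniform_qmatroid (k : nat) : qPolymatroid E :=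
  QPolymatroid (uniform_rank_bounds k) (@uniform_rank_mono k)
    (uniform_rank_submod k).

Definition convex_rank (lam : rat) M1 M2 V : rat :=
  (1 - lam) * M1 V + lam * M2 V.

Section Convex.
Variables (lam : rat) (lam01 : 0 <= lam <= 1) (M1 M2 : qPolymatroid E).

Fact convex_rank_bounds V : 0 <= convex_rank lam M1 M2 V <= (\dim V)%:R.
Proof.
have /andP[l0 l1] := lam01; rewrite /convex_rank.
have /andP[? ?] := qrank_bounds M1 V; have /andP[? ?] := qrank_bounds M2 V.
by apply/andP; split; nra.
Qed.

Fact convex_rank_mono V W :
  (V <= W)%VS -> convex_rank lam M1 M2 V <= convex_rank lam M1 M2 W.
Proof.
have /andP[l0 l1] := lam01; move=> sVW; rewrite /convex_rank.
by apply: lerD; apply: ler_wpM2l; rewrite ?subr_ge0 ?qrank_mono.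
Qed.

Fact convex_rank_submod V W :
  convex_rank lam M1 M2 (V + W)%VS + convex_rank lam M1 M2 (V :&: W)%VS
    <= convex_rank lam M1 M2 V + convex_rank lam M1 M2 W.
Proof.
have /andP[l0 l1] := lam01; rewrite /convex_rank.
have := qrank_submod M1 V W; have := qrank_submod M2 V W.
by nra.
Qed.

Definition convex_qpolymatroid : qPolymatroid E :=
  QPolymatroid convex_rank_bounds convex_rank_mono convex_rank_submod.

End Convex.

Definition qpm_denominator M (mu : rat) : Prop :=
  0 < mu /\ forall V, mu * M V \is a Num.nat.

Definition mu_independent M (mu : rat) (I : {vspace E}) : Prop :=
  forall J : {vspace E}, (J <= I)%VS -> (\dim J)%:R / mu <= M J.

End Constructions.

Arguments uniform_qmatroid {F} E k.

Fact lt01W (x : rat) : 0 < x < 1 -> 0 <= x <= 1.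
Proof. by move=> /andP[/ltW -> /ltW ->]. Qed.

Lemma convex_uniform_denominator (F : finFieldType) (E : vectType F)
    (k1 k2 : nat) (a mu : int) (lam : rat) (lamE : lam = a%:~R / mu%:~R)
    (lam01 : 0 < lam < 1) :
  0 < mu ->
  qpm_denominator (convex_qpolymatroid (lt01W lam01)
    (uniform_qmatroid E k1) (uniform_qmatroid E k2)) mu%:~R.
Proof.
move=> mu0; have mu0' : (0 : rat) < mu%:~R by rewrite ltr0z.
split=> // V; rewrite natrEint; apply/andP; split; last first.
  apply: mulr_ge0; first exact: ltW.
  by have /andP[] := qrank_bounds (convex_qpolymatroid (lt01W lam01)
    (uniform_qmatroid E k1) (uniform_qmatroid E k2)) V.
rewrite /= /convex_rank /= /uniform_rank mulrDr !mulrA mulrBr mulr1.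
have -> : mu%:~R * lam = a%:~R by rewrite lamE mulrC divfK // gt_eqF.
by rewrite rpredD // rpredM ?rpredB // ?intr_int // natr_int.
Qed.

(* Main.v *)
(** Since [k1 < k2], every convex combination of the two rank functions dominates
    that of the [k1]-uniform q-matroid. There [dim J <= mu * min k1 (dim J)]:
    [dim J <= mu * dim J] as [mu >= 1], and [dim J <= n <= mu * k1] is the
    hypothesis on the ceiling. *)

Require Import Defs.
From mathcomp Require Import all_boot all_order all_algebra.
Import Order.TTheory GRing.Theory Num.Theory.
Local Open Scope ring_scope.

Lemma uniform_rank_leq (F : finFieldType) (E : vectType F) (k1 k2 : nat)
    (V : {vspace E}) :
  (k1 <= k2)%N -> uniform_rank k1 V <= uniform_rank k2 V.
Proof. by move=> le_k; rewrite ler_nat leq_min geq_minr geq_min le_k. Qed.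

(** The combination equals [M1 V + lam * (M2 V - M1 V)], and the added term is nonnegative. *)
Lemma convex_rank_gel (F : finFieldType) (E : vectType F) (lam : rat)
    (M1 M2 : qPolymatroid E) (V : {vspace E}) :
  0 <= lam -> M1 V <= M2 V -> M1 V <= convex_rank lam M1 M2 V.
Proof.
move=> lam_ge0 le_M.
by rewrite /convex_rank mulrBl mul1r -addrA lerDl addrC -mulrBr mulr_ge0 ?subr_ge0.
Qed.

Lemma uniform_rank_mu_ge (F : finFieldType) (E : vectType F) (k : nat)
    (mu : rat) (V : {vspace E}) :
  1 <= mu -> (\dim V)%:R <= k%:R * mu ->
  (\dim V)%:R / mu <= uniform_rank k V.
Proof.
move=> mu_ge1 le_dim; rewrite ler_pdivrMr ?(lt_le_trans ltr01) //.
(* When the minimum is [k], the goal is [le_dim]; the case left has minimum [\dim V]. *)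
by rewrite /uniform_rank; case: leqP => // _; rewrite ler_peMr ?ler0n.
Qed.

Theorem theorem6p1 (F : finFieldType) (n k1 k2 : nat)
    (hk1 : (1 < k1)%N) (hk12 : (k1 < k2)%N) (hk2 : (k2 < n)%N)
    (a mu : int) (ha : 1 <= a) (hmu : 2 <= mu)
    (lam : rat) (hlam : lam = a%:~R / mu%:~R) (hlam01 : 0 < lam < 1)
    (hceil : Num.ceil (n%:R / k1%:R : rat) <= mu) :
  let E := 'rV[F]_n in
  let M1 := uniform_qmatroid E k1 in
  let M2 := uniform_qmatroid E k2 in
  let M := convex_qpolymatroid (lt01W hlam01) M1 M2 in
  forall V : {vspace E}, mu_independent M mu%:~R V.
Proof.
move=> E M1 M2 M V J _.
have lam_ge0 : 0 <= lam by have /andP[/ltW] := hlam01.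
have le_rank : M1 J <= M2 J by apply: uniform_rank_leq; apply: ltnW.
apply: le_trans (@convex_rank_gel _ _ lam M1 M2 J lam_ge0 le_rank).
apply: uniform_rank_mu_ge; first by rewrite ler1z (le_trans _ hmu).
have k1_gt0 : (0 : rat) < k1%:R by rewrite ltr0n ltnW.
have le_n : (n%:R : rat) <= k1%:R * mu%:~R.
  (* As [mu] is an integer, bounding the ceiling by [mu] is the same as bounding [n / k1] itself. *)
  by rewrite mulrC -ler_pdivrMr // -Num.Theory.ceil_le_int.
apply: le_trans le_n; rewrite ler_nat.
(* [J] lies in the full space of row vectors, whose dimension as a matrix space is [1 * n]. *)
by have := dimvS (subvf J); rewrite dimvf dim_matrix mul1r.
Qed.
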